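(* Let $m\geq 2$ be an integer. (1) Let $n\geq 3$, let $G=\langle x,y:~x^n=y^2=e,~yxy=x^{-1}\rangle$, $A=\langle x\rangle$, and let $D\subseteq A$ be a difference set in $A$ with parameters $\left(n,\frac{2n-1-\sqrt{8n-7}}{2},n+1-\sqrt{8n-7}\right)$, and $\Gamma(D)=\mathrm{Cay}(G,A^\#\cup yD)$. Then the lexicographic product $K_m[\Gamma(D)]$ is a strictly Deza dihedrant of WL-rank $5$. (2) The graph $K_m[K_4\times K_2]$ is a strictly Deza dihedrant of WL-rank $5$.
   Context: All graphs are finite, undirected, without loops and multiple edges. For a finite group $G$ with identity $e$, $G^\#=G\setminus\{e\}$. For $S\subseteq G$ with $e\notin S$, $S=S^{-1}$, $\mathrm{Cay}(G,S)$ has vertex set $G$ and edges $\{g,sg\}$, $g\in G$, $s\in S$. A dihedrant is a graph isomorphic to a Cayley graph over a dihedral group. A subset $D$ of a group $H$ is a difference set with parameters $(v,k,\lambda)$ if $|H|=v$, $|D|=k$, $\lambda$ is a positive integer, and every element of $H^\#$ is $d_1^{-1}d_2$ ($d_1,d_2\in D$) in exactly $\lambda$ ways. A $k$-regular graph on $n$ vertices is a Deza graph if there are nonnegative integers $a,b$ such that every pair of distinct vertices has either $a$ or $b$ common neighbours. A strictly Deza graph is a Deza graph that is not strongly regular and has diameter $2$. The WL-rank of a graph $\Gamma=(V,E)$ is the number of classes of the smallest coherent configuration on $V$ such that $E$ is a union of classes (for Cayley graphs $\mathrm{Cay}(G,S)$: the number of basic sets of the smallest S-ring over $G$ in which $S$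 is a union of basic sets). $K_m$ is the complete graph; $\Gamma_1\times\Gamma_2$ is the Cartesian product; the lexicographic product $\Gamma_1[\Gamma_2]$ has vertex set $V_1\times V_2$ with $(v_1,v_2)\sim(u_1,u_2)$ iff $v_1\sim u_1$ in $\Gamma_1$, or $v_1=u_1$ and $v_2\sim u_2$ in $\Gamma_2$. *)

(* Defs.v *)
From HB Require Import structures.
From mathcomp Require Import all_boot all_order all_algebra all_fingroup.

Set Implicit Arguments.
Unset Strict Implicit.
Unset Printing Implicit Defensive.

Section Graphs.

Variables (T : finType) (e : rel T).

Definition simple_graph := symmetric e /\ irreflexive e.

Definition regular_graph (k : nat) := forall u : T, #|[set w | e u w]| = k.

Definition common_neighbours (u v : T) : nat := #|[set w | e u w && e v w]|.

Definition strongly_regular := exists k lambda mu : nat,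
  [/\ simple_graph, regular_graph k,
      forall u v, e u v -> common_neighbours u v = lambda
    & forall u v, u != v -> ~~ e u v -> common_neighbours u v = mu].

Definition deza_graph := exists k a b : nat,
  [/\ simple_graph, regular_graph k
    & forall u v, u != v ->
        common_neighbours u v = a \/ common_neighbours u v = b].

Definition within_distance (d : nat) (u v : T) :=
  exists p : seq T, [/\ path e u p, last u p = v & size p <= d].

Definition has_diameter (d : nat) :=
  (forall u v, within_distance d u v) /\
  (exists u v, forall d', within_distance d' u v -> d <= d').

(* Complete and edgeless graphs count as strongly regular above; neither has
   diameter 2, so the usual convention excluding them gives the same notion. *)
Definition strictly_deza :=
  [/\ deza_graph, ~ strongly_regular & has_diameter 2].

End Graphs.

Definition isomorphic_graphs (T1 T2 : finType) (e1 : rel T1) (e2 : rel T2) :=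
  exists2 f : T1 -> T2, bijective f & forall u v, e2 (f u) (f v) = e1 u v.

Definition complete_graph (m : nat) : rel 'I_m := fun i j => i != j.

Definition cartesian_product (T1 T2 : finType) (e1 : rel T1) (e2 : rel T2) :
    rel (T1 * T2)%type :=
  fun u v => (u.1 == v.1) && e2 u.2 v.2 || e1 u.1 v.1 && (u.2 == v.2).

Definition lexicographic_product (T1 T2 : finType)
    (e1 : rel T1) (e2 : rel T2) : rel (T1 * T2)%type :=
  fun u v => e1 u.1 v.1 || (u.1 == v.1) && e2 u.2 v.2.

Section CoherentConfigurations.

Variable T : finType.
Implicit Types (E R S U : {set T * T}) (P Q : {set {set T * T}}).

Definition diagonal_relation : {set T * T} := [set p | p.1 == p.2].

Definition converse_relation R : {set T * T} := [set p | (p.2, p.1) \in R].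

Definition union_of_classes P E :=
  exists2 Q : {set {set T * T}}, Q \subset P & E = cover Q.

Definition intermediate_points R S (p : T * T) : nat :=
  #|[set w | ((p.1, w) \in R) && ((w, p.2) \in S)]|.

Definition coherent_configuration P :=
  [/\ partition P [set: T * T],
      union_of_classes P diagonal_relation,
      forall R, R \in P -> converse_relation R \in P
    & forall R S U, R \in P -> S \in P -> U \in P ->
      forall p q, p \in U -> q \in U ->
        intermediate_points R S p = intermediate_points R S q].

Definition edge_set (e : rel T) : {set T * T} := [set p | e p.1 p.2].

(* "Smallest" refers to the coarsest partition, i.e. the inclusion order on the
   families of relations that are unions of classes; such a P is unique. *)
Definition smallest_coherent_configuration (e : rel T) P :=
  [/\ coherent_configuration P, union_of_classes P (edge_set e)
    & forall Q, coherent_configuration Q -> union_of_classes Q (edge_set e) ->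
        forall R, R \in P -> union_of_classes Q R].

Definition has_WL_rank (e : rel T) (r : nat) :=
  exists2 P, smallest_coherent_configuration e P & #|P| = r.

End CoherentConfigurations.

Local Open Scope group_scope.

Definition is_dihedral_presentation (gT : finGroupType) (n : nat) : Prop :=
  [set: gT] \isog Grp (x : y : x ^+ n = y ^+ 2 = 1, y * x * y = x^-1).

(* gT is given by the presentation, and x, y are generators realizing it. *)
Definition dihedral_generators (gT : finGroupType) (n : nat) (x y : gT) :=
  [/\ is_dihedral_presentation gT n,
      <<[set x; y]>> = [set: gT],
      x ^+ n = 1, y ^+ 2 = 1 & y * x * y = x^-1].

Definition dihedral_group (gT : finGroupType) :=
  exists2 n : nat, 3 <= n & is_dihedral_presentation gT n.

(* The edges are {g, s g} with s in S; this is an undirected loopless graph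
   when 1 \notin S and S^-1 = S. *)
Definition cayley_graph (gT : finGroupType) (S : {set gT}) : rel gT :=
  fun g h => [exists s in S, h == s * g].

Definition dihedrant (T : finType) (e : rel T) :=
  exists (gT : finGroupType) (S : {set gT}),
    [/\ dihedral_group gT, 1 \notin S, S^-1 = S
      & isomorphic_graphs e (cayley_graph S)].

Definition difference_set (gT : finGroupType) (H : {group gT}) (D : {set gT})
    (v k lambda : nat) :=
  [/\ D \subset H, #|H| = v, #|D| = k, 0 < lambda
    & forall h, h \in H^# ->
        #|[set d in setX D D | d.1^-1 * d.2 == h]| = lambda].

Definition Gamma (gT : finGroupType) (x y : gT) (D : {set gT}) : rel gT :=
  cayley_graph (<[x]>^# :|: y *: D).

(* Main.v *)
Require Import Defs.
From HB Require Import structures.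
From mathcomp Require Import all_boot all_order all_algebra all_fingroup.
From mathcomp Require Import all_solvable ring lra zify.
Import GRing.Theory Num.Theory.

Set Implicit Arguments.
Unset Strict Implicit.
Unset Printing Implicit Defensive.

(** Both graphs consist of two disjoint n-cliques joined by the incidence
graph of a symmetric design with block size k and index lambda, where
lambda + n = 2k + 2 (for K_4 x K_2 the design is trivial, with n = 4, k = 1,
lambda = 0). Colour a pair of vertices of K_m[Gamma] by whether the vertices
lie in the same copy of Gamma, in the same clique, and are adjacent: this
gives five colours. The 0-1 matrices J, F (same copy), B (same clique),
C (cross edge) and I span an algebra closed under products, so the colouring
is a coherent configuration. With N = 2n(m-1) + 2k, two vertices have N
common neighbours, except that it is N - 2 for pairs in different copies and for
cross edges: the graph is a Deza graph, and it is not strongly regular since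
both values occur on edges. Any coherent configuration refining the edge set
sees the number of common neighbours, hence the colours "same clique" and
"cross non-edge"; composing these two separates cross edges from pairs in
different copies.

For the dihedrant property, Gamma = Cay(D_2n, S) gives
K_m[Gamma] = Cay(D_2mn, S'), where S' is S together with everything outside a
dihedral subgroup of order 2n. *)

(** * Coherent configurations from colourings *)

Section CoherentConfigurationTheory.

Variable T : finType.
Implicit Types (E R S U : {set T * T}) (P Q : {set {set T * T}}).

Definition saturated Q E :=
  forall U p q, U \in Q -> p \in U -> q \in U -> (p \in E) = (q \in E).

Lemma saturatedP Q E : partition Q [set: T * T] ->
  union_of_classes Q E <-> saturated Q E.
Proof.
case/and3P=> /eqP covQ trivQ _; split=> [[Q' sQ'Q ->] U p q QU pU qU | satE].
  have mem_class r : r \in U -> (r \in cover Q') = (U \in Q').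
    move=> rU; apply/bigcupP/idP => [[W Q'W rW] | Q'U]; last by exists U.
    by rewrite -(def_pblock trivQ QU rU)
         (def_pblock trivQ (subsetP sQ'Q W Q'W) rW).
  by rewrite !mem_class.
exists [set U in Q | U \subset E]; first by apply/subsetP=> U /setIdP[].
apply/setP=> p; apply/idP/bigcupP => [pE | [U /setIdP[_ /subsetP sUE] /sUE]] //.
have /bigcupP[U QU pU]: p \in cover Q by rewrite covQ inE.
exists U => //; rewrite inE QU /=; apply/subsetP=> q qU.
by rewrite -(satE U p q).
Qed.

(** For a disjoint family, the indicator of the union is the sum of the indicators of the members,
    so path counts are bilinear in the two relations. *)
Lemma intermediate_points_cover P Q (p : T * T) : trivIset P -> trivIset Q ->
  intermediate_points (cover P) (cover Q) p
    = (\sum_(R in P) \sum_(S in Q) intermediate_points R S p)%N.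
Proof.
have mem_coverE P' r : trivIset P' ->
    ((r \in cover P') = \sum_(R in P') (r \in R) :> nat)%N.
  move=> trivP; have [/bigcupP[R PR rR] | /bigcupP noR] := boolP (r \in _).
    rewrite (bigD1 R) //= rR big1 // => S /andP[PS neqSR].
    apply/eqP; rewrite eqb0; apply: contraNN neqSR => rS.
    by rewrite -(def_pblock trivP PR rR) (def_pblock trivP PS rS).
  by rewrite big1 // => R PR; case: (boolP (r \in R)) => // rR; case: noR; exists R.
have sumE R S :
    (intermediate_points R S p = \sum_w ((p.1, w) \in R) * ((w, p.2) \in S))%N.
  rewrite /intermediate_points -sum1dep_card big_mkcond.
  by apply: eq_bigr => w _; rewrite mulnb; case: (_ && _).
move=> trivP trivQ; rewrite sumE.
under eq_bigr => w _ do rewrite !mem_coverE // big_distrlr /=.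
rewrite exchange_big /=; apply: eq_bigr => R _.
by rewrite exchange_big /=; apply: eq_bigr => S _; rewrite sumE.
Qed.

(** Extends the coherence axiom from classes to unions of classes. It turns path counts between
    known relations into new invariants of the classes. *)
Lemma intermediate_points_saturated Q E F U p q : coherent_configuration Q ->
    saturated Q E -> saturated Q F -> U \in Q -> p \in U -> q \in U ->
  intermediate_points E F p = intermediate_points E F q.
Proof.
case=> partQ _ _ regQ satE satF QU pU qU.
have [_ trivQ _] := and3P partQ.
have [Q1 sQ1Q ->] := (saturatedP E partQ).2 satE.
have [Q2 sQ2Q ->] := (saturatedP F partQ).2 satF.
have [trivQ1 trivQ2] := (trivIsetS sQ1Q trivQ, trivIsetS sQ2Q trivQ).
rewrite !intermediate_points_cover //; apply: eq_bigr => R /(subsetP sQ1Q) QR.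
by apply: eq_bigr => S /(subsetP sQ2Q) QS; apply: (regQ R S U).
Qed.

Variables (I : finType) (c : T -> T -> I).

Definition colour_class i : {set T * T} := [set p | c p.1 p.2 == i].

Definition colour_classes : {set {set T * T}} := [set colour_class i | i : I].

Hypothesis c_onto : forall i, exists u v, c u v = i.

Lemma card_colour_classes : #|colour_classes| = #|I|.
Proof.
apply: card_imset => i j eq_ij; have [u [v cuv]] := c_onto i.
have: (u, v) \in colour_class i by rewrite inE /= cuv.
by rewrite eq_ij inE /= cuv => /eqP.
Qed.

(** For a symmetric colouring every class is its own converse, and surjectivity keeps the classes
    nonempty. What remains of coherence is that path counts depend only on the colour of the end
    points. *)
Lemma colour_classes_coherent i0 :
    (forall u v, (c u v == i0) = (u == v)) -> (forall u v, c u v = c v u) ->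
    (forall i j u v u' v', c u v = c u' v' ->
       #|[set w | (c u w == i) && (c w v == j)]|
         = #|[set w | (c u' w == i) && (c w v' == j)]|) ->
  coherent_configuration colour_classes.
Proof.
move=> diag_c sym_c reg_c; split.
- apply/and3P; split.
  + rewrite eqEsubset subsetT; apply/subsetP=> p _; apply/bigcupP.
    by exists (colour_class (c p.1 p.2)); rewrite ?imset_f ?inE.
  + apply/trivIsetP=> _ _ /imsetP[i _ ->] /imsetP[j _ ->] neq_ij.
    rewrite -setI_eq0; apply/eqP/setP=> p; rewrite !inE.
    by apply: contraNF neq_ij => /andP[/eqP <- /eqP <-].
  + apply/imsetP=> -[i _ /setP class0]; have [u [v cuv]] := c_onto i.
    by have:= class0 (u, v); rewrite !inE /= cuv eqxx.
- exists [set colour_class i0].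
    by rewrite sub1set imset_f.
  by rewrite /cover big_set1; apply/setP=> p; rewrite !inE diag_c.
- move=> _ /imsetP[i _ ->]; apply/imsetP; exists i => //.
  by apply/setP=> p; rewrite !inE /= sym_c.
- move=> _ _ _ /imsetP[i _ ->] /imsetP[j _ ->] /imsetP[l _ ->] [u v] [u' v'].
  rewrite !inE /= => /eqP cuv /eqP cuv'; rewrite /intermediate_points /=.
  have cardE (x y : T) :
      #|[set w | ((x, w) \in colour_class i) && ((w, y) \in colour_class j)]|
        = #|[set w | (c x w == i) && (c w y == j)]|.
    by apply: eq_card => w; rewrite !inE.
  by rewrite !cardE; apply: reg_c; rewrite cuv cuv'.
Qed.

End CoherentConfigurationTheory.
(** * Lexicographic products of K_m with two-clique designs *)

(** [tcd_parameters] equates the number n - 2 + lambda of common neighbours within a copy for two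
    vertices of a clique with the number 2k for a cross non-edge. The bounds on k make both cross
    edges and cross non-edges occur. *)
Record two_clique_design (T : finType) (side : T -> bool) (e : rel T)
    (n k lambda : nat) : Prop := TwoCliqueDesign {
  tcd_sym : symmetric e;
  tcd_clique : forall u v, side u = side v -> e u v = (u != v);
  tcd_card : forall b, #|[set w | side w == b]| = n;
  tcd_degree : forall u, #|[set w | (side u != side w) && e u w]| = k;
  tcd_meet : forall u v, side u = side v -> u != v ->
    #|[set w | [&& side u != side w, e u w & e w v]]| = lambda;
  tcd_parameters : lambda + n = k.*2 + 2;
  tcd_degree_gt0 : 0 < k;
  tcd_degree_lt : k < n }.

Section TwoCliqueDesign.

Variables (m : nat) (T : finType) (side : T -> bool) (e : rel T).
Variables (n k lambda : nat).
Hypothesis design : two_clique_design side e n k lambda.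

Let V := ('I_m * T)%type.

(** A clique is complete, so [Some (true, false)] means equality, and the five values of the type
    are exactly the five colours. *)
Definition colour (u v : V) : option (bool * bool) :=
  if u.1 == v.1 then Some (side u.2 == side v.2, e u.2 v.2) else None.

Definition same_copy (o : option (bool * bool)) := o != None.
(** The diagonal is included, so that B^2 = n B. *)
Definition same_clique (o : option (bool * bool))
    := if o is Some (b, _) then b else false.
Definition cross_edge o := o == Some (false, true).
Definition equal_pair o := o == Some (true, false).

Lemma colour_sym u v : colour u v = colour v u.
Proof.
by rewrite /colour (tcd_sym design) eq_sym [side u.2 == _]eq_sym.
Qed.

Lemma equal_pairE u v : equal_pair (colour u v) = (u == v).
Proof.
case: u v => i s [j t]; rewrite /colour xpair_eqE /=; case: (i == j) => //.
rewrite /equal_pair -[_ == _]/((_, _) == (_, _)) xpair_eqE eqb_id eqbF_neg /=.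
have [eq_st|neq_st] := eqVneq (side s) (side t).
  by rewrite (tcd_clique design eq_st) negbK.
by apply/esym; apply: contraNF neq_st => /eqP->.
Qed.

Local Open Scope ring_scope.

Lemma sum_indicator (W : finType) (P : pred W) :
  \sum_w (P w)%:R = #|[set w | P w]|%:R :> int.
Proof. by rewrite -sum1dep_card natr_sum [RHS]big_mkcond; apply: eq_bigr => w _;
    case: (P w). Qed.

Lemma sum_copy i (P : pred T) :
  \sum_(w : V) ((i == w.1) && P w.2)%:R = #|[set t | P t]|%:R :> int.
Proof.
rewrite (@sum_indicator V (fun w => (i == w.1) && P w.2)).
rewrite -[#|[set t | P t]|]mul1n -(cards1 i) -cardsX.
by congr (_%:R); apply: eq_card => -[j t]; rewrite !inE eq_sym.
Qed.

Lemma card_design : #|T| = (2 * n)%N.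
Proof.
rewrite -(cardsC [set w | side w == true]) mul2n -addnn.
congr addn; first exact: (tcd_card design).
rewrite -[RHS](tcd_card design false).
by apply: eq_card => w; rewrite !inE; case: (side w).
Qed.

Lemma sum_same_copy u : \sum_w (same_copy (colour u w))%:R = (2 * n)%:R :> int.
Proof.
rewrite (eq_bigr (fun w : V => ((u.1 == w.1) && true)%:R)); last first.
  by move=> w _; rewrite /colour /same_copy; case: (u.1 == w.1).
by rewrite (sum_copy _ (fun=> true)) cardsE -/#|T| card_design.
Qed.

Lemma sum_same_clique u : \sum_w (same_clique (colour u w))%:R = n%:R :> int.
Proof.
rewrite (eq_bigr (fun w : V => ((u.1 == w.1) && (side w.2 == side u.2))%:R)).
  by rewrite (sum_copy _ (fun t => side t == side u.2)) (tcd_card design).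
by move=> w _; rewrite /colour /same_clique [side u.2 == _]eq_sym;
    case: (u.1 == w.1).
Qed.

Lemma sum_cross_edge u : \sum_w (cross_edge (colour u w))%:R = k%:R :> int.
Proof.
rewrite (eq_bigr (fun w : V =>
    ((u.1 == w.1) && ((side u.2 != side w.2) && e u.2 w.2))%:R)).
  by rewrite (sum_copy _ (fun t => (side u.2 != side t) && e u.2 t))
    (tcd_degree design).
by move=> w _; rewrite /colour /cross_edge; case: (u.1 == w.1);
    case: (side _ == _); case: (e _ _).
Qed.

Lemma sum_equal_pair u : \sum_w (equal_pair (colour u w))%:R = 1 :> int.
Proof.
rewrite (eq_bigr (fun w => (w == u)%:R)) => [|w _];
    last by rewrite equal_pairE eq_sym.
by rewrite sum_indicator cardsE card1.
Qed.

(** The matrix identity C^2 = k I + lambda (B - I): a path of two cross edges returns to its clique;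
    the closed ones are counted by the degree, the others by the index of the design. *)
Lemma sum_cross_edges u v :
  \sum_w (cross_edge (colour u w))%:R * (cross_edge (colour w v))%:R
    = k%:R * (equal_pair (colour u v))%:R
      + lambda%:R * ((same_clique (colour u v))%:R - (equal_pair (colour u v))%:R)
    :> int.
Proof.
have [-> | neq_uv] := eqVneq u v.
  rewrite -(sum_cross_edge v) equal_pairE eqxx /same_clique /colour !eqxx.
  rewrite subrr mulr0 addr0 mulr1; apply: eq_bigr => w _.
  by rewrite -!/(colour _ _) [colour w v]colour_sym -natrM mulnb andbb.
rewrite equal_pairE (negPf neq_uv) mulr0 add0r subr0.
case: u v neq_uv => i s [j t]; rewrite xpair_eqE /colour /=.
have [-> /= neq_st | neq_ij _] := eqVneq i j; last first.
  rewrite mulr0 big1 // => w _; have [eq_iw | neq_iw] := eqVneq i w.1.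
    by rewrite -eq_iw (negPf neq_ij) mulr0.
  by rewrite mul0r.
have [eq_st | neq_side] := eqVneq (side s) (side t); last first.
  rewrite mulr0 big1 // => w _; rewrite [w.1 == _]eq_sym; case: (_ == _);
      last by rewrite mulr0.
  by rewrite /=; case: (side s) (side t) (side w.2) neq_side => [] [] [] //=;
      rewrite ?mul0r ?mulr0.
rewrite mulr1 -(tcd_meet design eq_st neq_st) -(sum_copy j); apply: eq_bigr => w _.
rewrite [w.1 == _]eq_sym [side w.2 == _]eq_sym -eq_st; case: (_ == w.1) => //=.
by case: (side s == _); case: (e s _); case: (e _ t).
Qed.

(* Linear combinations of J, F, B, C and I, in this order. *)
Definition combination (a : int * int * int * int * int) o : int :=
  let: (a0, a1, a2, a3, a4) := a in
  a0 + a1 * (same_copy o)%:R + a2 * (same_clique o)%:R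
     + a3 * (cross_edge o)%:R + a4 * (equal_pair o)%:R.

(** Inverts the triangular system [combination]: F lies in J, B and C lie in F, and I lies in B, so
    the coefficients are differences of values. *)
Definition coordinates (phi : option (bool * bool) -> int) :=
  let: apart := phi None in
  let: nonedge := phi (Some (false, false)) in
  let: cross := phi (Some (false, true)) in
  let: clique := phi (Some (true, true)) in
  let: diag := phi (Some (true, false)) in
  (apart, nonedge - apart, clique - nonedge, cross - nonedge, diag - clique).

Lemma combination_coordinates phi o : phi o = combination (coordinates phi) o.
Proof. by rewrite /combination /coordinates; case: o => [[[] []]|] /=; ring. Qed.

(** The multiplication table: J turns the other factor into its row sum, F^2 = 2n F, FB = BF = n F,
    FC = CF = k F, B^2 = n B, BC = CB = k (F - B), and C^2 is given by [sum_cross_edges]. *)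
Definition combination_product (a b : int * int * int * int * int) o : int :=
  let: (a0, a1, a2, a3, a4) := a in
  let: (b0, b1, b2, b3, b4) := b in
  let F : int := (same_copy o)%:R in
  let B : int := (same_clique o)%:R in
  let C : int := (cross_edge o)%:R in
  let I : int := (equal_pair o)%:R in
  let n : int := n%:R in let k : int := k%:R in
  a0 * b0 * (m%:R * (2 * n)) + a0 * (b1 * (2 * n) + b2 * n + b3 * k + b4)
  + b0 * (a1 * (2 * n) + a2 * n + a3 * k + a4)
  + (a1 * b1 * (2 * n) + a1 * b2 * n + a2 * b1 * n + a1 * b3 * k + a3 * b1 * k) * F
  + a2 * b2 * n * B + (a2 * b3 + a3 * b2) * k * (F - B)
  + a3 * b3 * (k * I + lambda%:R * (B - I))
  + (a1 * b4 + a4 * b1) * F + (a2 * b4 + a4 * b2) * B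
  + (a3 * b4 + a4 * b3) * C + a4 * b4 * I.

(** Closure of the span under products; the intersection numbers and the numbers of common
    neighbours are both instances. *)
Lemma colour_product phi psi u v :
  \sum_w phi (colour u w) * psi (colour w v)
    = combination_product (coordinates phi) (coordinates psi) (colour u v).
Proof.
under eq_bigr => w _ do rewrite [phi _]combination_coordinates
    [psi _]combination_coordinates.
move: (coordinates phi) (coordinates psi)
    => [[[[a0 a1] a2] a3] a4] [[[[b0 b1] b2] b3] b4].
rewrite /combination /combination_product.
pose F x y : int := (same_copy (colour x y))%:R.
pose B x y : int := (same_clique (colour x y))%:R.
pose C x y : int := (cross_edge (colour x y))%:R.
pose I x y : int := (equal_pair (colour x y))%:R.
rewrite -![(same_copy _)%:R]/(F _ _) -![(same_clique _)%:R]/(B _ _).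
rewrite -![(cross_edge _)%:R]/(C _ _) -![(equal_pair _)%:R]/(I _ _).
under eq_bigr => w _.
  rewrite -![(same_copy _)%:R]/(F _ _) -![(same_clique _)%:R]/(B _ _).
  rewrite -![(cross_edge _)%:R]/(C _ _) -![(equal_pair _)%:R]/(I _ _).
  over.
(* Each product of two indicators is rewritten so that w occurs in one factor only; the exception is
   C times C, left to [sum_cross_edges]. *)
have Iu X w : I u w * X w v = I u w * X u v.
  by rewrite /I equal_pairE; case: eqP => [->|]; rewrite ?mul0r.
have Iv X w : X u w * I w v = X u v * I w v.
  by rewrite /I equal_pairE; case: eqP => [->|]; rewrite ?mulr0.
have FX w : [/\ F u w * F w v = F u w * F u v, B u w * F w v = B u w * F u v,
                C u w * F w v = C u w * F u v
              & B u w * B w v = B u w * B u v].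
  rewrite /F /B /C /colour; have [<-|_] := eqVneq u.1 w.1; last by rewrite !mul0r.
  case: (u.1 == v.1); last by rewrite !mulr0.
  by split=> //; case: (side u.2) (side w.2) (side v.2) => [] [] [].
have XF w : F u w * B w v = F u v * B w v /\ F u w * C w v = F u v * C w v.
  rewrite /F /B /C /colour; have [<-|_] := eqVneq w.1 v.1; last by rewrite !mulr0.
  by case: (u.1 == w.1).
have BC w : B u w * C w v = (F u v - B u v) * C w v.
  rewrite /F /B /C /colour; have [<-|_] := eqVneq w.1 v.1; last by rewrite !mulr0.
  case: (u.1 == w.1); last by rewrite mul0r.
  by case: (side u.2) (side w.2) (side v.2) (e w.2 v.2) => [] [] [] [].
have CB w : C u w * B w v = C u w * (F u v - B u v).
  rewrite /F /B /C /colour; have [<-|_] := eqVneq u.1 w.1; last by rewrite !mul0r.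
  case: (u.1 == v.1); last by rewrite mulr0.
  by case: (side u.2) (side w.2) (side v.2) (e u.2 w.2) => [] [] [] [].
pose f := F u v; pose b := B u v; pose c := C u v; pose i := I u v.
(* Factors at (w, v) are flipped to (v, w) by symmetry, so that the row sums apply to every term. *)
transitivity (\sum_w (a0 * b0
    + (a1 * b0 + a1 * b1 * f) * F u w + (a2 * b0 + a2 * b1 * f + a2 * b2 * b) * B u w
    + (a3 * b0 + a3 * b1 * f + a3 * b2 * (f - b)) * C u w
    + (a4 * b0 + a4 * (b1 * f + b2 * b + b3 * c + b4 * i)) * I u w
    + a0 * b1 * F v w + (a0 * b2 + a1 * b2 * f) * B v w
    + (a0 * b3 + a1 * b3 * f + a2 * b3 * (f - b)) * C v w
    + (a0 * b4 + a1 * b4 * f + a2 * b4 * b + a3 * b4 * c) * I v w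
    + a3 * b3 * (C u w * C w v))).
  apply: eq_bigr => w _; have [FF BF CF BB] := FX w; have [FB FC] := XF w.
  have -> : F v w = F w v by rewrite /F colour_sym.
  have -> : B v w = B w v by rewrite /B colour_sym.
  have -> : C v w = C w v by rewrite /C colour_sym.
  have -> : I v w = I w v by rewrite /I colour_sym.
  rewrite /f /b /c /i.
  (* The 25 products are spelled out so that the rewrite rules find them. *)
  transitivity (a0 * b0 + a0 * b1 * (F w v) + a0 * b2 * (B w v)
      + a0 * b3 * (C w v) + a0 * b4 * (I w v)
      + a1 * b0 * (F u w) + a1 * b1 * (F u w * F w v) + a1 * b2 * (F u w * B w v)
        + a1 * b3 * (F u w * C w v) + a1 * b4 * (F u w * I w v)
      + a2 * b0 * (B u w) + a2 * b1 * (B u w * F w v) + a2 * b2 * (B u w * B w v)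
        + a2 * b3 * (B u w * C w v) + a2 * b4 * (B u w * I w v)
      + a3 * b0 * (C u w) + a3 * b1 * (C u w * F w v) + a3 * b2 * (C u w * B w v)
        + a3 * b3 * (C u w * C w v) + a3 * b4 * (C u w * I w v)
      + a4 * b0 * (I u w) + a4 * b1 * (I u w * F w v) + a4 * b2 * (I u w * B w v)
        + a4 * b3 * (I u w * C w v) + a4 * b4 * (I u w * I w v)).
    by ring.
  rewrite FF BF CF BB FB FC BC CB (Iu F) (Iu B) (Iu C) (Iu I) (Iv F) (Iv B) (Iv C).
  by ring.
rewrite !big_split /= -!mulr_sumr sum_cross_edges.
rewrite !sum_same_copy !sum_same_clique !sum_cross_edge !sum_equal_pair.
rewrite sumr_const -mulr_natr card_prod card_ord card_design !natrM /f /b /c /i.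
by ring.
Qed.

(** * The Deza property and the diameter of K_m[Gamma] *)

Definition joined (o : option (bool * bool)) := if o is Some (_, a) then a else true.

Let L := lexicographic_product (@complete_graph m) e.

Lemma lexicographic_joined u v : L u v = joined (colour u v).
Proof.
by rewrite /L /lexicographic_product /complete_graph /colour; case: (u.1 == v.1).
Qed.

Lemma colour_onto o : (1 < m)%N -> exists u v, colour u v = o.
Proof.
move=> m_gt1; have [k_gt0 k_lt] := (tcd_degree_gt0 design, tcd_degree_lt design).
pose i0 : 'I_m := Ordinal (ltnW m_gt1).
have [s s_true]: exists s, side s = true.
  have /card_gt0P[s]: (0 < #|[set w | side w == true]|)%N.
    by rewrite (tcd_card design) (leq_ltn_trans _ k_lt).
  by rewrite inE => /eqP; exists s.
have card_other : #|[set w | side s != side w]| = n.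
  rewrite -(tcd_card design false); apply: eq_card => w.
  by rewrite !inE s_true; case: (side w).
have same_colour t : side s = side t -> colour (i0, s) (i0, t) = Some (true, s != t).
  by move=> eq_st; rewrite /colour eqxx eq_st eqxx (tcd_clique design).
case: o => [[[] []]|].
(* From 0 < k < n the clique of s has two vertices, at least one of which differs from s. *)
- have: (1 < #|[set w | side w == true]|)%N.
    by rewrite (tcd_card design) (leq_ltn_trans _ k_lt).
  case/card_gt1P=> t [t'] []; rewrite !inE => /eqP t_true /eqP t'_true neq_tt'.
  have [eq_st | neq_st] := eqVneq s t.
    exists (i0, s), (i0, t'); rewrite same_colour ?s_true ?t'_true //.
    by rewrite eq_st neq_tt'.
  by exists (i0, s), (i0, t); rewrite same_colour ?s_true ?t_true // neq_st.
- by exists (i0, s), (i0, s); rewrite same_colour // eqxx.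
- have /card_gt0P[t]: (0 < #|[set w | (side s != side w) && e s w]|)%N.
    by rewrite (tcd_degree design).
  rewrite inE => /andP[/negPf neq_st est]; exists (i0, s), (i0, t).
  by rewrite /colour eqxx neq_st est.
- have: ~~ ([set w | side s != side w] \subset
    [set w | (side s != side w) && e s w]).
    apply/negP=> /subset_leq_card.
    by rewrite card_other (tcd_degree design) leqNgt k_lt.
  case/subsetPn=> t; rewrite !inE => neq_st; rewrite neq_st /= => /negPf est.
  by exists (i0, s), (i0, t); rewrite /colour eqxx (negPf neq_st) est.
- by exists (i0, s), (Ordinal m_gt1, s).
Qed.

Definition colour_indicator (o o' : option (bool * bool)) : int := (o' == o)%:R.

Lemma colour_intersection i j u v :
  #|[set w | (colour u w == i) && (colour w v == j)]|%:R
    = combination_product (coordinates (colour_indicator i))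
        (coordinates (colour_indicator j)) (colour u v).
Proof.
rewrite -colour_product -(@sum_indicator V (fun w => (_ == i) && (_ == j))).
by apply: eq_bigr => w _; rewrite /colour_indicator -natrM mulnb.
Qed.

Definition joined_indicator o : int := (joined o)%:R.

Lemma joined_product u v :
  #|[set w | L u w && L w v]|%:R
    = combination_product (coordinates joined_indicator)
        (coordinates joined_indicator) (colour u v).
Proof.
rewrite -colour_product -(@sum_indicator V (fun w => L u w && L w v)).
by apply: eq_bigr => w _;
    rewrite /joined_indicator -natrM mulnb !lexicographic_joined.
Qed.

Lemma lexicographic_sym : symmetric L.
Proof. by move=> u v; rewrite !lexicographic_joined colour_sym. Qed.

Lemma common_neighboursE u v :
  common_neighbours L u v = #|[set w | L u w && L w v]|.
Proof. by apply: eq_card => w; rewrite !inE [L v w]lexicographic_sym. Qed.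

Lemma common_neighbours_colour u v : (0 < m)%N -> u != v ->
  common_neighbours L u v = ((m.-1 * (2 * n) + k.*2)
    - (if (colour u v == None) || (colour u v == Some (false, true)) then 2 else
        0))%N.
Proof.
move=> m_gt0 neq_uv; apply/eqP;
    rewrite -(eqr_nat int) common_neighboursE joined_product.
have := equal_pairE u v; rewrite (negPf neq_uv).
have k_gt0 := tcd_degree_gt0 design.
have param : lambda%:R + n%:R = k%:R *+ 2 + 2 :> int.
  by rewrite -!natrD (tcd_parameters design) -muln2 natrD natrM mulr_natr.
(* The truncated subtraction is exact because k > 0. *)
rewrite natrB; last by case: ifP => // _; apply: leq_trans (leq_addl _ _);
    rewrite -muln2; lia.
rewrite natrD natrM -muln2 [(k * 2)%:R]natrM [(2 * n)%:R]natrM -subn1 natrB //.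
(* Eliminating lambda makes clique edges and cross non-edges agree; each of the four off-diagonal
   colours leaves a polynomial identity. *)
have {param} lambdaE : lambda%:R = k%:R *+ 2 + 2 - n%:R :> int.
  by rewrite -param addrK.
case: (colour u v) => [[[] []]|] //= _;
  rewrite /combination_product /coordinates /joined_indicator
    /same_copy /same_clique /cross_edge /equal_pair /= lambdaE; apply/eqP; ring.
Qed.

Local Close Scope ring_scope.

Lemma colour_refl u : colour u u = Some (true, false).
Proof. by have := equal_pairE u u; rewrite eqxx => /eqP. Qed.

Lemma lexicographic_irrefl : irreflexive L.
Proof. by move=> u; rewrite lexicographic_joined colour_refl. Qed.

(** The degree counts the closed paths of length two, so it is the value of the squared adjacency
    matrix at the diagonal colour. *)
Lemma lexicographic_degree u v : #|[set w | L u w]| = #|[set w | L v w]|.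
Proof.
have degreeE x : #|[set w | L x w]| = #|[set w | L x w && L w x]|.
  by apply: eq_card => w; rewrite !inE [L w x]lexicographic_sym andbb.
apply/eqP; rewrite -(eqr_nat int) !degreeE !joined_product !colour_refl.
exact: eqxx.
Qed.

Hypothesis m_gt1 : 1 < m.

Let m_gt0 : 0 < m := ltnW m_gt1.

Lemma lexicographic_deza : deza_graph L.
Proof.
have [u0 _] := colour_onto None m_gt1.
exists #|[set w | L u0 w]|, (m.-1 * (2 * n) + k.*2), (m.-1 * (2 * n) + k.*2 - 2).
split; first by split; [exact: lexicographic_sym | exact: lexicographic_irrefl].
  by move=> u; exact: lexicographic_degree.
move=> u v neq_uv; rewrite common_neighbours_colour //.
by case: ifP; [right | left; rewrite subn0].
Qed.

Lemma neq_colour u v o : colour u v = o -> ~~ equal_pair o -> u != v.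
Proof. by move=> <-; rewrite equal_pairE. Qed.

Lemma common_neighbours_ge2 : 2 <= m.-1 * (2 * n) + k.*2.
Proof.
apply: leq_trans (leq_addl _ _); have k_gt0 := tcd_degree_gt0 design.
by rewrite -muln2; lia.
Qed.

Lemma lexicographic_not_strongly_regular : ~ strongly_regular L.
Proof.
case=> d [l [mu [_ _ adj_l _]]].
have [u1 [v1 cu1]] := colour_onto (Some (true, true)) m_gt1.
have [u2 [v2 cu2]] := colour_onto None m_gt1.
have: common_neighbours L u1 v1 = common_neighbours L u2 v2.
  by rewrite !adj_l // lexicographic_joined ?cu1 ?cu2.
rewrite !common_neighbours_colour ?(neq_colour cu1) ?(neq_colour cu2) //.
by rewrite cu1 cu2 /= subn0 => eqN; have := common_neighbours_ge2; lia.
Qed.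

Lemma lexicographic_diameter : has_diameter L 2.
Proof.
split=> [u v |]; last first.
  (* A cross non-edge realises the diameter: paths of length 0 and 1 are excluded. *)
  have [u [v cuv]] := colour_onto (Some (false, false)) m_gt1.
  exists u, v => d [[|w [|w' p]]] [] //=.
    by move=> _ eq_uv; have := neq_colour cuv isT; rewrite eq_uv eqxx.
    by rewrite andbT => + eq_wv; rewrite eq_wv lexicographic_joined cuv.
  by move=> _ _; exact: leq_trans.
have [-> | neq_uv] := eqVneq u v; first by exists [::].
have [Luv | nLuv] := boolP (L u v); first by exists [:: v]; rewrite /= Luv.
(* Distinct non-adjacent vertices form a cross non-edge and so have N >= 2 common neighbours. *)
have: 0 < common_neighbours L u v.
  move: nLuv; rewrite lexicographic_joined common_neighbours_colour //.
  case: ifP => [/orP[] /eqP -> // | _ _].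
  by rewrite subn0 (leq_trans _ common_neighbours_ge2).
rewrite common_neighboursE => /card_gt0P[w]; rewrite inE => /andP[Luw Lwv].
by exists [:: w; v]; rewrite /= Luw Lwv.
Qed.

Lemma lexicographic_strictly_deza : strictly_deza L.
Proof.
split; [exact: lexicographic_deza | exact: lexicographic_not_strongly_regular |].
exact: lexicographic_diameter.
Qed.

(** * The WL-rank of K_m[Gamma] *)

Lemma colouring_coherent : coherent_configuration (colour_classes colour).
Proof.
apply: (@colour_classes_coherent _ _ colour _ (Some (true, false))).
- by move=> o; exact: colour_onto.
- exact: equal_pairE.
- exact: colour_sym.
move=> i j u v u' v' eq_c.
by apply/eqP; rewrite -(eqr_nat int) !colour_intersection eq_c.
Qed.

(** The minimality half of the rank: the colours are recovered one after another from the diagonal,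
    the edges and counts of paths of length two. *)
Lemma saturated_colour Q o : coherent_configuration Q ->
  union_of_classes Q (edge_set L) -> saturated Q (colour_class colour o).
Proof.
move=> cohQ unionE; have [partQ unionI _ _] := cohQ.
have satE := (saturatedP (edge_set L) partQ).1 unionE.
have satI := (saturatedP (diagonal_relation _) partQ).1 unionI.
pose E := edge_set L; pose clique := colour_class colour (Some (true, true)).
pose nonedge := colour_class colour (Some (false, false)).
have cnE p : common_neighbours L p.1 p.2 = intermediate_points E E p.
  by rewrite common_neighboursE; apply: eq_card => w; rewrite !inE.
(* Among edges, the clique edges have N and the others N - 2 common neighbours;
   [common_neighbours_ge2] keeps the two apart under truncated subtraction. *)
have sat_clique : saturated Q clique.
  move=> U p q QU pU qU; have
      := intermediate_points_saturated cohQ satE satE QU pU qU.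
  have := satE U p q QU pU qU; have := satI U p q QU pU qU.
  rewrite -!cnE !inE !lexicographic_joined.
  case: eqVneq => [eqp | neqp]; case: eqVneq => [eqq | neqq] // _.
    by rewrite eqp eqq !colour_refl.
  rewrite !common_neighbours_colour // => eq_adj; have := common_neighbours_ge2.
  by case: (colour p.1 p.2) eq_adj => [[[] []]|]; case: (colour q.1 q.2)
      => [[[] []]|] //= _; lia.
(* Cross non-edges are the non-adjacent pairs off the diagonal. *)
have sat_nonedge : saturated Q nonedge.
  move=> U p q QU pU qU.
  have := satE U p q QU pU qU; have := satI U p q QU pU qU.
  rewrite !inE !lexicographic_joined -!equal_pairE.
  by case: (colour p.1 p.2) => [[[] []]|]; case: (colour q.1 q.2) => [[[] []]|].
have path_colour p : (intermediate_points clique nonedge p)%:R%R =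
    combination_product (coordinates (colour_indicator (Some (true, true))))
      (coordinates (colour_indicator (Some (false, false)))) (colour p.1 p.2).
  rewrite -colour_intersection; congr _%:R%R.
  by apply: eq_card => w; rewrite !inE.
(* Paths made of a clique edge and then a cross non-edge: there are none between different copies,
   but n - k > 0 between the ends of a cross edge. *)
have apart_not_cross U p q : U \in Q -> p \in U -> q \in U ->
    colour p.1 p.2 = None -> colour q.1 q.2 <> Some (false, true).
  move=> QU pU qU cp cq; have k_lt := tcd_degree_lt design.
  have := path_colour q; have := path_colour p; rewrite cp cq.
  rewrite (intermediate_points_saturated cohQ sat_clique sat_nonedge QU pU qU) => ->.
  rewrite /combination_product /colour_indicator /= /same_copy /same_clique.
  rewrite /cross_edge /equal_pair /=; lia.
move=> U p q QU pU qU; suff eq_c : colour p.1 p.2 = colour q.1 q.2.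
  by rewrite !inE eq_c.
have := sat_clique U p q QU pU qU; have := sat_nonedge U p q QU pU qU.
have := satE U p q QU pU qU; have := satI U p q QU pU qU.
have := apart_not_cross U p q QU pU qU; have := apart_not_cross U q p QU qU pU.
rewrite !inE !lexicographic_joined -!equal_pairE.
(* The saturated relations separate all colours except different copies from cross edges, where h1
   and h2 apply. *)
by case: (colour p.1 p.2) (colour q.1 q.2) => [[[] []]|] [[[] []]|] h1 h2 //=;
  first [case: (h1 erefl erefl) | case: (h2 erefl erefl)].
Qed.

Lemma lexicographic_WL_rank : has_WL_rank L 5.
Proof.
exists (colour_classes colour); last first.
  rewrite card_colour_classes => [|o]; last exact: colour_onto.
  by rewrite card_option card_prod card_bool.
have [partP _ _ _] := colouring_coherent.
split; [exact: colouring_coherent | |].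
  apply/(saturatedP _ partP) => _ p q /imsetP[o _ ->]; rewrite !inE
      => /eqP cp /eqP cq.
  by rewrite !lexicographic_joined cp cq.
move=> Q cohQ unionE _ /imsetP[o _ ->]; have [partQ _ _ _] := cohQ.
by apply/(saturatedP _ partQ); apply: saturated_colour.
Qed.

End TwoCliqueDesign.

(** * Dihedral groups *)

Section DihedralGroups.

Local Open Scope group_scope.

Lemma involution_inv (gT : finGroupType) (y : gT) : y ^+ 2 = 1 -> y^-1 = y.
Proof. by move=> y2; rewrite -[y^-1]mulg1 -y2 expgS expg1 mulKg. Qed.

Lemma involution_conjg (gT : finGroupType) (x y : gT) :
  y ^+ 2 = 1 -> x ^ y = y * x * y.
Proof. by move=> y2; rewrite conjgE involution_inv // mulgA. Qed.

(** Passes from the relation y x y = x^-1 to the conjugation form of [Grp_dihedral]; the two agree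
    because y is an involution. *)
Lemma dihedral_homE (gT : finGroupType) (H : {group gT}) (n : nat) :
  (H \homg Grp (x : y : x ^+ n = y ^+ 2 = 1, y * x * y = x^-1))
    = (H \homg Grp (x : y : x ^+ n, y ^+ 2, x ^ y = x^-1)).
Proof.
apply/existsP/existsP=> -[[x y]] /=; rewrite !xpair_eqE /= => /and4P[genH].
  move=> /eqP xn_y2 /eqP y2 yxy; exists (x, y).
  by rewrite !xpair_eqE /= genH involution_conjg // xn_y2 y2 eqxx.
move=> /eqP xn /eqP y2 xy; exists (x, y).
by rewrite !xpair_eqE /= genH -involution_conjg // xn y2 eqxx.
Qed.

Lemma dihedral_presentationE (gT : finGroupType) (n : nat) :
  is_dihedral_presentation gT n <->
    [set: gT] \isog Grp (x : y : x ^+ n, y ^+ 2, x ^ y = x^-1).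
Proof. by split=> presG rT H; rewrite presG dihedral_homE. Qed.

Section Presented.

Variables (gT : finGroupType) (n : nat).
Hypotheses (n_gt1 : 1 < n) (presG : is_dihedral_presentation gT n).

(** A presentation determines the group up to isomorphism, and ['D_(n.*2)] has the same one. *)
Lemma card_dihedral_presentation : #|gT| = n.*2.
Proof.
rewrite -cardsT -(card_dihedral n_gt1); apply: card_isog.
have presG' := (dihedral_presentationE gT n).1 presG.
by rewrite isogEhom (Grp_dihedral n_gt1) presG' !isoGrp_hom //; apply: Grp_dihedral.
Qed.

(** The relations give a map from the presented group onto K, and equality of orders makes it
    injective. *)
Lemma dihedral_isog (rT : finGroupType) (K : {group rT}) (x y : rT) :
    #|K| = n.*2 -> <[x]> <*> <[y]> = K -> x ^+ n = 1 -> y ^+ 2 = 1 ->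
  x ^ y = x^-1 -> K \isog [set: gT].
Proof.
move=> oK genK xn y2 xy; apply/(isoGrpP _ ((dihedral_presentationE gT n).1 presG)).
rewrite cardsT card_dihedral_presentation; split=> //.
by apply/existsP; exists (x, y); rewrite /= !xpair_eqE /= genK xn y2 xy !eqxx.
Qed.

End Presented.

Section Generators.

Variables (gT : finGroupType) (x y : gT).
Hypotheses (y2 : y ^+ 2 = 1) (xy : x ^ y = x^-1).

Lemma reflection_inverts a : a \in <[x]> -> y * a * y = a^-1.
Proof.
by case/cycleP=> i ->; rewrite -involution_conjg // conjXg xy expgVn.
Qed.

Lemma reflectionK : y * y = 1. Proof. by rewrite -y2. Qed.

Lemma reflection_commute a : a \in <[x]> -> y * a = a^-1 * y.
Proof. by move=> /reflection_inverts <-; rewrite -mulgA reflectionK mulg1. Qed.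

Lemma reflection_normalises : <[y]> \subset 'N(<[x]>).
Proof. by rewrite cycle_subG; apply/normP; rewrite -cycleJ xy cycleV. Qed.

Lemma order_reflection : y \notin <[x]> -> #[y] = 2.
Proof.
move=> nXy; apply: nt_prime_order => //.
by apply: contraNneq nXy => ->; apply: group1.
Qed.

Lemma card_dihedral_join : y \notin <[x]> -> #|<[x]> <*> <[y]>| = #[x].*2.
Proof.
move=> nXy; have oy := order_reflection nXy.
rewrite norm_joinEr ?reflection_normalises // TI_cardMg -?orderE ?oy ?muln2 //.
by rewrite setIC prime_TIg -?orderE ?oy // cycle_subG.
Qed.

Hypothesis genG : <[x]> <*> <[y]> = [set: gT].
Variable n : nat.
Hypotheses (n_gt0 : 0 < n) (xn : x ^+ n = 1) (oG : #|gT| = n.*2).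

(** Otherwise x alone would generate the group, which would then have at most n elements. *)
Lemma reflection_notin : y \notin <[x]>.
Proof.
apply/negP; rewrite -cycle_subG => /joing_idPl genX.
have: #[x] <= n by rewrite dvdn_leq // order_dvdn xn.
by rewrite orderE -genX genG cardsT oG; lia.
Qed.

Lemma order_rotation : #[x] = n.
Proof.
apply: double_inj; rewrite -card_dihedral_join ?reflection_notin //.
by rewrite genG cardsT.
Qed.

Lemma rotation_or_reflection g :
  g \notin <[x]> -> exists2 a, a \in <[x]> & g = y * a.
Proof.
move=> nXg; have: g \in <[y]> * <[x]>.
  by rewrite -norm_joinEl ?reflection_normalises // joingC genG inE.
rewrite [<[y]>]cycle2g; last exact: order_reflection reflection_notin.
case/mulsgP=> z a; rewrite !inE => /pred2P[] -> Xa eqg.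
  by rewrite eqg mul1g Xa in nXg.
by exists a.
Qed.

Lemma reflection_coset a : a \in <[x]> -> y * a \notin <[x]>.
Proof. by move=> Xa; rewrite groupMr // reflection_notin. Qed.

End Generators.

Lemma dihedral_generatorsP (gT : finGroupType) (n : nat) (x y : gT) :
    1 < n -> dihedral_generators n x y ->
  [/\ y ^+ 2 = 1, x ^ y = x^-1, <[x]> <*> <[y]> = [set: gT], x ^+ n = 1
    & #|gT| = n.*2].
Proof.
move=> n_gt1 [presG genG xn y2 yxy]; split=> //.
- by rewrite involution_conjg.
- by rewrite joing_idl joing_idr.
- exact: card_dihedral_presentation.
Qed.

Lemma dihedral_generators_exist (n : nat) :
  1 < n -> exists (gT : finGroupType) (x y : gT), dihedral_generators n x y.
Proof.
move=> n_gt1; exists ('D_(n.*2))%type.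
have presD : is_dihedral_presentation ('D_(n.*2))%type n.
  exact/dihedral_presentationE/Grp_dihedral.
have: [set: ('D_(n.*2))%type] \homg Grp (x : y : x ^+ n, y ^+ 2, x ^ y = x^-1).
  by apply/isoGrp_hom/dihedral_presentationE.
case/existsP=> -[x y]; rewrite /= !xpair_eqE /=
    => /and4P[/eqP genD /eqP xn /eqP y2 /eqP xy].
exists x, y; split=> //; last by rewrite -involution_conjg.
by rewrite -genD joing_idl joing_idr.
Qed.

End DihedralGroups.

(** * Lexicographic products as dihedrants *)

Section Dihedrants.

Local Open Scope group_scope.

Lemma cayley_graphE (gT : finGroupType) (S : {set gT}) (g h : gT) :
  cayley_graph S g h = (h * g^-1 \in S).
Proof.
apply/existsP/idP => [[s /andP[Ss /eqP ->]] | hgS]; first by rewrite mulgK.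
by exists (h * g^-1); rewrite hgS mulgKV eqxx.
Qed.

(* S' consists of the image of S in K and of all elements outside K, so that
   distinct cosets of K are completely joined. *)
Lemma lexicographic_cayley_isomorphic (m : nat) (gT rT : finGroupType)
    (K : {group rT}) (S : {set gT}) :
    [set: gT] \isog K -> #|[set: rT] : K| = m -> 1 \notin S -> S^-1 = S ->
  exists S' : {set rT}, [/\ 1 \notin S', S'^-1 = S' &
    isomorphic_graphs (lexicographic_product (@complete_graph m) (cayley_graph S))
      (cayley_graph S')].
Proof.
move=> isoK indexK nS1 SV; have := card_isog isoK; rewrite cardsT => oK.
case/isogP: isoK => f injf imf.
have f_inj : injective f by move=> g h; apply: (injmP injf); rewrite inE.
have fM g h : f (g * h) = f g * f h by rewrite morphM ?inE.
have fV g : f g^-1 = (f g)^-1 by rewrite morphV ?inE.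
have f1 : f 1 = 1 by apply: morph1.
have Kf g : f g \in K by rewrite -imf mem_morphim ?inE.
(* The copies of the graph are indexed by the right cosets of K, with representatives [r i]. *)
pose r (i : 'I_m) := repr (enum_val (cast_ord (esym indexK) i)).
have r_inj i j : r i * (r j)^-1 \in K -> i = j.
  have coset_r l : K :* r l = enum_val (cast_ord (esym indexK) l).
    have /rcosetsP[z _ eqz] := enum_valP (cast_ord (esym indexK) l).
    by rewrite /r eqz rcoset_repr.
  rewrite -mem_rcoset => /rcoset_eqP; rewrite !coset_r => /enum_val_inj.
  exact: cast_ord_inj.
(* Copy i goes to the coset of [r i]; the representative cancels in quotients of two elements of one
   coset. *)
pose h (u : 'I_m * gT) := f u.2 * r u.1.
have h_quotient u v : h v * (h u)^-1 = f v.2 * (r v.1 * (r u.1)^-1) * (f u.2)^-1.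
  by rewrite /h invMg !mulgA.
have same_coset u v : (h v * (h u)^-1 \in K) = (u.1 == v.1).
  rewrite h_quotient groupMr ?groupV // groupMl //.
  by apply/idP/eqP => [/r_inj | ->]; rewrite ?mulgV.
have h_same u v : u.1 = v.1 -> h v * (h u)^-1 = f (v.2 * u.2^-1).
  by move=> eq_i; rewrite h_quotient eq_i mulgV mulg1 fM fV.
exists (~: K :|: f @: S); split.
- rewrite !inE group1 /=; apply: contra nS1 => /imsetP[s Ss].
  by rewrite -f1 => /f_inj ->.
- apply/setP=> z; rewrite !inE groupV; congr (_ || _).
  have SinvE s : (s^-1 \in S) = (s \in S) by rewrite -[in LHS]SV memV_invg.
  apply/imsetP/imsetP=> [] [s Ss eqz]; exists s^-1;
      rewrite ?SinvE ?fV -?eqz ?invgK //.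
exists h => [|u v].
  apply: inj_card_bij => [u v eq_h|].
    have eq_i: u.1 = v.1 by apply/eqP; rewrite -same_coset eq_h mulgV.
    have: f (v.2 * u.2^-1) = f 1 by rewrite -h_same // eq_h mulgV.
    case: u v {eq_h} eq_i => i g [j g'] /= -> /f_inj /eqP.
    by rewrite -eq_mulgV1 => /eqP ->.
  by rewrite card_prod card_ord -cardsT -(Lagrange (subsetT K)) indexK -oK mulnC.
rewrite !cayley_graphE /lexicographic_product /complete_graph inE in_setC.
rewrite same_coset /=; case: eqP => //= eq_i.
by rewrite h_same // mem_imset // cayley_graphE.
Qed.

Lemma lexicographic_cayley_dihedrant (m n : nat) (gT : finGroupType) (S : {set gT}) :
    0 < m -> 2 < n -> is_dihedral_presentation gT n -> 1 \notin S -> S^-1 = S ->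
  dihedrant (lexicographic_product (@complete_graph m) (cayley_graph S)).
Proof.
move=> m_gt0 n_gt2 presG nS1 SV.
have mn_gt2 : 2 < m * n by rewrite (leq_trans n_gt2) // leq_pmull.
have [rT [x [y gens]]] := dihedral_generators_exist (ltnW mn_gt2).
have [presD _ _ _ _] := gens.
have [y2 xy genD xmn oD] := dihedral_generatorsP (ltnW mn_gt2) gens.
have mn_gt0 : 0 < m * n by apply: leq_trans mn_gt2.
have ox := order_rotation y2 xy genD mn_gt0 xmn oD.
have nXy := reflection_notin genD mn_gt0 xmn oD.
have oxm : #[x ^+ m] = n by rewrite orderXdiv ox ?dvdn_mulr // mulKn.
have xmy : (x ^+ m) ^ y = (x ^+ m)^-1 by rewrite conjXg xy expgVn.
(* In the dihedral group of order 2mn, x^m has order n, so K is dihedral of order 2n and index m. *)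
pose K := <[x ^+ m]> <*> <[y]>.
have oK : #|K| = n.*2.
  rewrite -[in RHS]oxm card_dihedral_join //.
  by apply: contra nXy; apply/subsetP/cycleX.
have isoK : [set: gT] \isog K.
  rewrite isog_sym; apply: (dihedral_isog (ltnW n_gt2) presG oK) => //.
  by rewrite -oxm expg_order.
have indexK : #|[set: rT] : K| = m.
  by rewrite -divgS ?subsetT // cardsT oD oK -!muln2 -mulnA mulnK // muln_gt0
      (ltnW (ltnW n_gt2)).
have [S' [nS'1 S'V isoS']] := lexicographic_cayley_isomorphic isoK indexK nS1 SV.
exists rT, S'; split=> //.
by exists (m * n)%N.
Qed.

Lemma isomorphic_lexicographic (m : nat) (T1 T2 : finType) (e1 : rel T1) (e2 :
    rel T2) :
    isomorphic_graphs e1 e2 ->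
  isomorphic_graphs (lexicographic_product (@complete_graph m) e1)
    (lexicographic_product (@complete_graph m) e2).
Proof.
case=> f [g fK gK] f_iso; exists (fun u => (u.1, f u.2)).
  by exists (fun u => (u.1, g u.2)) => -[i t] /=; rewrite ?fK ?gK.
by move=> u v; rewrite /lexicographic_product /= f_iso.
Qed.

Lemma isomorphic_dihedrant (T1 T2 : finType) (e1 : rel T1) (e2 : rel T2) :
  isomorphic_graphs e1 e2 -> dihedrant e2 -> dihedrant e1.
Proof.
case=> f bij_f f_iso [gT [S [dihG nS1 SV [h bij_h h_iso]]]].
exists gT, S; split=> //; exists (h \o f); first exact: bij_comp.
by move=> u v; rewrite /= h_iso f_iso.
Qed.

(** Serves to carry the design of Gamma with D = {1} over to K_4 x K_2. *)
Lemma isomorphic_two_clique_design (T1 T2 : finType) (e1 : rel T1) (e2 : rel T2)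
    (f : T1 -> T2) (side : T2 -> bool) (n k lambda : nat) :
    bijective f -> (forall u v, e2 (f u) (f v) = e1 u v) ->
  two_clique_design side e2 n k lambda ->
  two_clique_design (side \o f) e1 n k lambda.
Proof.
move=> bij_f f_iso [sym2 clique2 card2 degree2 meet2 param k_gt0 k_lt].
have card_f (P : pred T2) : #|[set w | P (f w)]| = #|[set w | P w]|.
  rewrite -(on_card_preimset (onW_bij _ bij_f)).
  by apply: eq_card => w; rewrite !inE.
split=> // [u v | u v eq_side | b | u | u v eq_side neq_uv].
- by rewrite -!f_iso sym2.
- by rewrite -f_iso clique2 // (bij_eq bij_f).
- by rewrite -(card2 b) (card_f (fun w => side w == b)).
- rewrite -(degree2 (f u)) -card_f.
  by apply: eq_card => w; rewrite !inE f_iso.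
rewrite -(meet2 (f u) (f v)) ?(bij_eq bij_f) // -card_f.
by apply: eq_card => w; rewrite !inE !f_iso.
Qed.

End Dihedrants.

(** * The graphs of the theorem as two-clique designs *)

Section GammaDesign.

Local Open Scope group_scope.

Variables (gT : finGroupType) (n : nat) (x y : gT).
Hypotheses (n_gt1 : 1 < n) (gens : dihedral_generators n x y).

Let y2 : y ^+ 2 = 1. Proof. by have [] := dihedral_generatorsP n_gt1 gens. Qed.
Let xy : x ^ y = x^-1. Proof. by have [] := dihedral_generatorsP n_gt1 gens. Qed.
Let genG : <[x]> <*> <[y]> = [set: gT].
Proof. by have [] := dihedral_generatorsP n_gt1 gens. Qed.
Let xn : x ^+ n = 1. Proof. by have [] := dihedral_generatorsP n_gt1 gens. Qed.
Let oG : #|gT| = n.*2. Proof. by have [] := dihedral_generatorsP n_gt1 gens. Qed.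
Let n_gt0 : 0 < n := ltnW n_gt1.

(** Being a rotation is a parity, since the rotations have index 2. *)
Lemma quotient_is_rotation g h : (h * g^-1 \in <[x]>) = ((g \in <[x]>) == (h \in
    <[x]>)).
Proof.
have nX := reflection_coset genG n_gt0 xn oG.
have [Xg | /(rotation_or_reflection y2 xy genG n_gt0 xn oG)[a Xa ->]]
    := boolP (g \in _).
  by rewrite groupMr ?groupV.
(* A reflection is its own inverse. *)
have -> : (y * a)^-1 = y * a by rewrite {1}(reflection_commute y2 xy Xa) invMg
    invgK (involution_inv y2).
have [Xh | /(rotation_or_reflection y2 xy genG n_gt0 xn oG)[b Xb ->]]
    := boolP (h \in _).
  by rewrite groupMl // (negPf (nX a Xa)).
by rewrite mulgA (reflection_inverts y2 xy Xb) groupM ?groupV.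
Qed.

Variable D : {set gT}.
Hypothesis sDX : D \subset <[x]>.

Lemma reflection_coset_notin g : g \in y *: D -> g \notin <[x]>.
Proof.
case/lcosetP=> d Dd ->; apply: (reflection_coset genG n_gt0 xn oG).
exact: (subsetP sDX).
Qed.

Lemma Gamma_connection_set1 : 1 \notin <[x]>^# :|: y *: D.
Proof.
rewrite !inE eqxx /=; apply/negP=> /reflection_coset_notin.
by rewrite group1.
Qed.

(** The rotations form a subgroup, and each element of yD is its own inverse. *)
Lemma Gamma_connection_setV : (<[x]>^# :|: y *: D)^-1 = <[x]>^# :|: y *: D.
Proof.
suff sub g : g \in <[x]>^# :|: y *: D -> g^-1 \in <[x]>^# :|: y *: D.
  apply/setP=> g; rewrite inE; apply/idP/idP => /sub //.
  by rewrite invgK.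
rewrite !in_setU !in_setD1 => /orP[/andP[g1 Xg] | ].
  by rewrite eq_invg1 g1 groupV Xg.
case/lcosetP=> d Dd ->; rewrite (reflection_commute y2 xy (subsetP sDX d Dd)).
by rewrite invMg invgK (involution_inv y2) mem_lcoset mulKg Dd orbT.
Qed.

Let side (g : gT) := g \in <[x]>.

Lemma Gamma_same_side g h : side g = side h -> Gamma x y D g h = (g != h).
Proof.
move=> eq_side; rewrite /Gamma cayley_graphE in_setU in_setD1.
have Xq : h * g^-1 \in <[x]> by rewrite quotient_is_rotation -/(side g) eq_side eqxx.
rewrite Xq andbT -eq_mulgV1 eq_sym orb_idr //.
by move/reflection_coset_notin; rewrite Xq.
Qed.

Lemma Gamma_cross g h : (side g != side h) && Gamma x y D g h = (h * g^-1 \in y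
    *: D).
Proof.
rewrite /Gamma cayley_graphE in_setU in_setD1 -quotient_is_rotation.
by have [/reflection_coset_notin/negPf-> | _] := boolP (_ \in y *: D);
  rewrite ?orbT ?orbF //; case: (_ \in <[x]>); rewrite ?andbF.
Qed.

Lemma Gamma_two_clique_design (k lambda : nat) :
    #|D| = k ->
    (forall h, h \in <[x]>^# ->
       #|[set d in setX D D | d.1^-1 * d.2 == h]| = lambda) ->
    lambda + n = k.*2 + 2 -> 0 < k -> k < n ->
  two_clique_design side (Gamma x y D) n k lambda.
Proof.
move=> oD diffD param k_gt0 k_lt.
have Gamma_sym : symmetric (Gamma x y D).
  move=> g h; rewrite /Gamma !cayley_graphE -[in RHS]Gamma_connection_setV.
  by rewrite mem_invg invMg invgK.
have oX : #|[set g | side g]| = n.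
  rewrite -[RHS](order_rotation y2 xy genG n_gt0 xn oG).
  by apply: eq_card => g; rewrite !inE.
split=> //.
- exact: Gamma_same_side.
- case; first by rewrite -oX; apply: eq_card => g; rewrite !inE eqb_id.
  have := cardsC [set g | side g]; rewrite oX oG -addnn => /addnI <-.
  by apply: eq_card => g; rewrite !inE eqbF_neg.
(* The neighbours of g in the other clique form the translate yDg. *)
- move=> g; rewrite -oD -(card_lcoset D y) -(card_rcoset (y *: D) g).
  by apply: eq_card => h; rewrite inE Gamma_cross mem_rcoset.
(* The vertices counted are w = y d1 g = y d2 h, that is, d1^-1 d2 = g h^-1, a nontrivial
   rotation. *)
move=> g h eq_side neq_gh; rewrite -(diffD (g * h^-1)); last first.
  by rewrite in_setD1 -eq_mulgV1 neq_gh quotient_is_rotation -/(side g) eq_side eqxx.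
(* The pair (d1, d2) corresponds to w = y d1 g; it is injective because d1 and the quotient
   determine d2. *)
rewrite -(@card_in_imset _ _ (fun d => y * d.1 * g)) => [|[d1 d2] [d1' d2']];
    last first.
  rewrite !inE /= => /andP[_ /eqP def_d2] /andP[_ /eqP def_d2'].
  move/mulIg/mulgI=> eq_d1; congr pair => //; apply: (mulgI d1^-1).
  by rewrite def_d2 eq_d1 def_d2'.
apply: eq_card => w; rewrite inE [Gamma x y D w h]Gamma_sym.
rewrite (_ : [&& _, _ & _] = (w * g^-1 \in y *: D) && (w * h^-1 \in y *: D));
    last first.
  by rewrite -!Gamma_cross -eq_side; case: (side g != side w) => //=; rewrite andbF.
apply/andP/imsetP => [[/lcosetP[d1 Dd1 def1] /lcosetP[d2 Dd2 def2]] | ].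
  exists (d1, d2); last by rewrite /= -def1 mulgKV.
  rewrite !inE Dd1 Dd2 /= -[d1](mulKg y) -[d2](mulKg y) -def1 -def2.
  by rewrite !invMg !invgK; apply/eqP; rewrite !mulgA mulgK mulgKV.
case=> -[d1 d2]; rewrite !inE /= => /andP[/andP[Dd1 Dd2] /eqP def_d] ->.
rewrite mulgK mem_lcoset mulKg Dd1; split=> //.
by rewrite -mulgA -def_d -mulgA mulKVg mem_lcoset mulKg.
Qed.

Lemma Gamma_dihedrant (m : nat) : 0 < m -> 2 < n ->
  dihedrant (lexicographic_product (@complete_graph m) (Gamma x y D)).
Proof.
move=> m_gt0 n_gt2; have [presG _ _ _ _] := gens.
apply: (lexicographic_cayley_dihedrant m_gt0 n_gt2 presG).
  exact: Gamma_connection_set1.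
exact: Gamma_connection_setV.
Qed.

End GammaDesign.

Section K4K2.

Local Open Scope group_scope.

(** For D = {1} the cross edges join g to y g, the perfect matching between the two copies of K_n.
    The vertex (i, a) becomes [y ^+ a * x ^+ i], so left multiplication by y changes a and keeps
    i. *)
Lemma cartesian_K_K2_Gamma (n : nat) (gT : finGroupType) (x y : gT) :
    1 < n -> dihedral_generators n x y ->
  exists2 f : 'I_n * 'I_2 -> gT, bijective f &
    forall u v, Gamma x y [set 1] (f u) (f v)
      = cartesian_product (@complete_graph n) (@complete_graph 2) u v.
Proof.
move=> n_gt1 gens; have [y2 xy genG xn oG] := dihedral_generatorsP n_gt1 gens.
have n_gt0 := ltnW n_gt1.
have ox := order_rotation y2 xy genG n_gt0 xn oG.
have sX : [set 1] \subset <[x]> by rewrite sub1set group1.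
pose f (u : 'I_n * 'I_2) := y ^+ u.2 * x ^+ u.1.
have sideE u : (f u \in <[x]>) = (u.2 == ord0).
  rewrite /f groupMr ?mem_cycle //; case: u => i [[|[|//]] ?] /=.
    by rewrite expg0 group1.
  by rewrite expg1; apply/negbTE/(reflection_notin genG n_gt0 xn oG).
have ord2 (a b : 'I_2) : (a == ord0) = (b == ord0) -> a = b.
  by case: a b => [[|[|//]] ?] [[|[|//]] ?] //= _; apply: val_inj.
have f_inj : injective f.
  move=> u v eq_f; have eq2 : u.2 = v.2 by apply: ord2; rewrite -!sideE eq_f.
  case: u v eq2 eq_f => i a [j b] /= ->; rewrite /f /= => /mulgI/eqP.
  by rewrite eq_expg_mod_order ox !modn_small // => /eqP/val_inj ->.
exists f => [|u v].
  by apply: inj_card_bij; rewrite // card_prod !card_ord oG muln2.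
have [eq2 | neq2] := eqVneq u.2 v.2.
  rewrite (Gamma_same_side n_gt1 gens sX) ?sideE ?eq2 // (inj_eq f_inj).
  rewrite /cartesian_product /complete_graph eq2 eqxx andbF andbT /=.
  by case: u v eq2 => i a [j b] /= ->; rewrite xpair_eqE eqxx andbT.
have neq_side : (f u \in <[x]>) != (f v \in <[x]>).
  by rewrite !sideE; apply: contraNneq neq2 => /ord2 ->.
have := Gamma_cross n_gt1 gens sX (f u) (f v); rewrite neq_side /= => ->.
rewrite /cartesian_product /complete_graph neq2 (negPf neq2) andbF orbF andbT.
have yf : y * f u = f (u.1, v.2).
  rewrite /f mulgA -expgS /=; congr (_ * _).
  by case: u v neq2 {neq_side} => i [[|[|//]] ?] [j [[|[|//]] ?]] //= _; rewrite y2.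
rewrite mem_lcoset inE mulgA -eq_mulgV1 -(inj_eq (mulgI y)) mulKVg yf (inj_eq f_inj).
by case: u v {neq2 neq_side yf} => i a [j b]; rewrite xpair_eqE eqxx andbT eq_sym.
Qed.

End K4K2.

(** * Arithmetic of the parameters and the two families *)

Local Open Scope ring_scope.

(** The square root cancels in lambda - 2k = 2 - n. *)
Lemma symmetric_design_parameters (R : rcfType) (n k lambda : nat) :
    (3 <= n)%N -> (0 < lambda)%N ->
    k%:R = (2 * n%:R - 1 - Num.sqrt (8 * n%:R - 7)) / 2 :> R ->
    lambda%:R = n%:R + 1 - Num.sqrt (8 * n%:R - 7) :> R ->
  [/\ lambda + n = k.*2 + 2, 0 < k & k < n]%N.
Proof.
move=> n_ge3 lambda_gt0 eqk eql; have s_ge0 := sqrtr_ge0 (8 * n%:R - 7 : R).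
have param : (lambda + n = k.*2 + 2)%N.
  apply/eqP; rewrite -(eqr_nat R) -muln2 !natrD natrM eqk eql; apply/eqP; lra.
(* The square root is nonnegative, so 2k <= 2n - 1 and k < n. *)
have k_le : ((k * 2) + 1 <= n * 2)%N.
  by rewrite -(ler_nat R) natrD !natrM eqk; lra.
(* Positivity of k follows from 2k + 2 = lambda + n >= 4. *)
by split=> //; [lia | lia].
Qed.

Theorem theorem1p2 (m : nat) (hm : (2 <= m)%N) :
  (forall (R : rcfType) (n : nat) (gT : finGroupType) (x y : gT)
      (D : {set gT}) (k lambda : nat),
    (3 <= n)%N ->
    dihedral_generators n x y ->
    difference_set <[x]>%G D n k lambda ->
    k%:R = (2 * n%:R - 1 - Num.sqrt (8 * n%:R - 7)) / 2 :> R ->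
    lambda%:R = n%:R + 1 - Num.sqrt (8 * n%:R - 7) :> R ->
    let L := lexicographic_product (@complete_graph m) (Gamma x y D) in
    [/\ strictly_deza L, dihedrant L & has_WL_rank L 5]) /\
  (let L := lexicographic_product (@complete_graph m)
              (cartesian_product (@complete_graph 4) (@complete_graph 2)) in
   [/\ strictly_deza L, dihedrant L & has_WL_rank L 5]).
Proof.
split=> [R n gT x y D k lambda n_ge3 gens [sDX _ oD lambda_gt0 diffD] eqk eql L | L].
  have [param k_gt0 k_lt] := symmetric_design_parameters n_ge3 lambda_gt0 eqk eql.
  have design := Gamma_two_clique_design (ltnW n_ge3) gens sDX oD diffD param
      k_gt0 k_lt.
  split; first exact: lexicographic_strictly_deza design hm.
    exact (Gamma_dihedrant (ltnW n_ge3) gens sDX (ltnW hm) n_ge3).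
  exact: lexicographic_WL_rank design hm.
have lt14 : (1 < 4)%N by [].
have [gT [x [y gens]]] := dihedral_generators_exist lt14.
have [f bij_f f_iso] := cartesian_K_K2_Gamma lt14 gens.
have s1X : [set 1%g] \subset <[x]>%g by rewrite sub1set group1.
(* The only quotient from D = {1} is 1, so lambda = 0; with k = 1 and n = 4 the parameter equation
   reads 0 + 4 = 2 + 2. *)
have diff1 h : h \in <[x]>^#%g ->
    #|[set d in setX [set 1%g] [set 1%g] | (d.1^-1 * d.2)%g == h]| = 0%N.
  rewrite in_setD1 => /andP[h1 _]; apply/eqP; rewrite cards_eq0;
      apply/eqP/setP=> -[d1 d2].
  rewrite !inE; apply: contraNF h1 => /andP[/andP[/eqP/= -> /eqP/= ->]].
  by rewrite invg1 mul1g eq_sym.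
have design := Gamma_two_clique_design lt14 gens s1X (cards1 1%g) diff1 erefl isT
    isT.
have {}design := isomorphic_two_clique_design bij_f f_iso design.
split; first exact: lexicographic_strictly_deza design hm.
  apply: (isomorphic_dihedrant (e2
      := lexicographic_product (@complete_graph m) (Gamma x y [set 1%g]))).
    by apply: isomorphic_lexicographic; exists f.
  exact (Gamma_dihedrant lt14 gens s1X (ltnW hm) isT).
exact: lexicographic_WL_rank design hm.
Qed.
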